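(* Let $q$ be a prime power, $n,k$ integers with $1<k<n-1$, and $V=\mathbb{F}_q^n$. If $m$ is an integer satisfying $m(n,k)\le m\le k-2$ and $n\ge [k-m]_q\cdot(q+1)+m$, then there exist $X,Y\in\mathcal{C}(n,k)_q$ such that $d(X,Y)=k-m$ and $d_c(X,Y)=k-m+1$.
   Context: $\mathbb{F}_q$ is the finite field with $q$ elements. For $i=1,\dots,n$, $C_i=\{(x_1,\dots,x_n)\in V: x_i=0\}$. A non-degenerate linear $[n,k]_q$ code is a $k$-dimensional subspace of $V$ not contained in any $C_i$; $\mathcal{C}(n,k)_q$ is the set of all such codes. The Grassmann graph $\Gamma_k(V)$ has as vertices the $k$-dimensional subspaces of $V$, two adjacent iff their intersection is $(k-1)$-dimensional; its graph distance is $d(X,Y)=k-\dim(X\cap Y)$. $\Gamma(n,k)_q$ is the induced subgraph of $\Gamma_k(V)$ on $\mathcal{C}(n,k)_q$ (it is connected), and $d_c(X,Y)$ denotes the graph distance in $\Gamma(n,k)_q$. Notation: $[j]_q=\frac{q^j-1}{q-1}$, and $m(n,k)=k-\min\{k,n-k\}$. *)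

(* Defs.v *)
From HB Require Import structures.
From mathcomp Require Import all_boot all_order all_algebra.

Set Implicit Arguments.
Unset Strict Implicit.
Unset Printing Implicit Defensive.

Import GRing.Theory.
Local Open Scope ring_scope.

(* A graph is given by a boolean adjacency relation; [graph_dist e x y d] says
   that [d] is the length of a shortest [e]-walk from [x] to [y]
   (in particular, such a walk exists). *)
Definition graph_dist (T : eqType) (e : rel T) (x y : T) (d : nat) : Prop :=
  (exists p : seq T, [/\ path e x p, last x p = y & size p = d])
  /\ (forall p : seq T, path e x p -> last x p = y -> (d <= size p)%N).

Definition induced_rel (T : Type) (A : pred T) (e : rel T) : rel T :=
  fun x y => [&& A x, A y & e x y].

Section Codes.
Variables (F : finFieldType) (n : nat).
Local Notation V := 'rV[F]_n.

(* The coordinate hyperplane x_i = 0, as the kernel of the i-th coordinate map. *)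
Definition coord_hyperplane (i : 'I_n) : {vspace V} :=
  lker (linfun (col i : V -> 'cV[F]_1)).

Lemma mem_coord_hyperplane (i : 'I_n) (x : V) :
  (x \in coord_hyperplane i) = (x 0 i == 0).
Proof.
rewrite memv_ker lfunE /=; apply/eqP/eqP => [/matrixP/(_ 0 0)|x0].
  by rewrite !mxE.
by apply/matrixP => a b; rewrite !mxE !ord1.
Qed.

(* Membership in C(n,k)_q, for q = #|F|. *)
Definition nondeg_code (k : nat) (X : {vspace V}) : bool :=
  (\dim X == k) && [forall i : 'I_n, ~~ (X <= coord_hyperplane i)%VS].

(* The successor avoids the truncated k - 1 at k = 0. *)
Definition grassmann_adj (k : nat) : rel {vspace V} :=
  fun X Y => [&& \dim X == k, \dim Y == k & (\dim (X :&: Y)%VS).+1 == k].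

Definition code_adj (k : nat) : rel {vspace V} :=
  induced_rel (nondeg_code k) (grassmann_adj k).

End Codes.

(* [j]_q; the division is exact when q > 1. *)
Definition qint (q j : nat) : nat := ((q ^ j - 1) %/ (q - 1))%N.

(* m(n,k); both subtractions are exact when k <= n. *)
Definition mnk (n k : nat) : nat := (k - minn k (n - k))%N.

(* Main.v *)
(* Put t = k - m and write X = U + A, Y = U + B with U = X :&: Y of dimension m and
   dim A = dim B = t. Coordinates of F^n restrict to pairs of functionals on A and
   on B. Choose them so that every hyperplane of X through U is X :&: C_i for the
   q + 1 coordinates i of a block, and so that in each block the functionals on B
   run over a pencil; then every y in Y has a zero coordinate in every block. The
   first step of a geodesic from X to Y goes to H + <y> with H a hyperplane of X
   through U and y in Y, which therefore lies in some C_i, so d_c(X, Y) > t. For the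
   same reason every vector of X + Y has a zero coordinate, so the all-one vector w
   is not in X + Y: for hyperplanes H of X and L of Y through U, every subspace on a
   geodesic from H + <w> to L + <w> contains w, hence is a code, and this gives a
   path from X to Y of length t + 1. *)
Require Import Defs.
From HB Require Import structures.
From mathcomp Require Import all_boot all_order all_algebra.
From mathcomp Require Import zify.

Set Implicit Arguments.
Unset Strict Implicit.
Unset Printing Implicit Defensive.

Import GRing.Theory.
Local Open Scope ring_scope.

(** * Dimension counts for subspaces *)

Section Subspaces.
Variables (K : fieldType) (vT : vectType K).
Implicit Types (U W X Y Z H : {vspace vT}) (x : vT).

Lemma dim_add_line U x : x \notin U -> \dim (U + <[x]>) = (\dim U).+1.
Proof.
move=> xU; rewrite dimv_disjoint_sum ?dim_vline; last first.
  apply/eqP; rewrite -subv0; apply/subvP=> y /[!memv_cap]/andP[yU /vlineP[c eqy]].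
  rewrite memv0 eqy; have [->|c0] := eqVneq c 0; first by rewrite scale0r.
  by case/negP: xU; rewrite -[x](scalerK c0) -eqy memvZ.
by rewrite (_ : x != 0) ?addn1 //; apply: contraNneq xU => ->; rewrite mem0v.
Qed.

Lemma exists_notin U X : (\dim U < \dim X)%N -> exists2 x, x \in X & x \notin U.
Proof. by move=> ltUX; apply/subvPn; apply: contraTN ltUX => /dimvS; rewrite -leqNgt. Qed.

Lemma eq_dim_subv U X : (U <= X)%VS -> (\dim X <= \dim U)%N -> U = X.
Proof. by move=> sUX leXU; apply/eqP; rewrite eqEdim sUX. Qed.

Lemma exists_hyperplane_between U X :
  (U <= X)%VS -> (\dim U < \dim X)%N ->
  exists H, [/\ (U <= H)%VS, (H <= X)%VS & (\dim H).+1 = \dim X].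
Proof.
move: {2}(\dim X - \dim U)%N (leqnn (\dim X - \dim U)) => d.
elim: d U => [|d IHd] U led sUX ltUX; first by lia.
have [eqUX|neqUX] := eqVneq (\dim U).+1 (\dim X); first by exists U.
have [x xX xU] := exists_notin ltUX.
have dimUx := dim_add_line xU.
case: (IHd (U + <[x]>)%VS); rewrite ?dimUx; try lia.
  by rewrite subv_add sUX -memvE.
move=> H [sUH sHX dimH]; exists H; split=> //.
exact: subv_trans (addvSl _ _) sUH.
Qed.

(** Adding [x] raises the dimensions of [U], [W] and [U + W] by one each, so by the dimension
    formula that of the intersection also grows by one. *)
Lemma dim_cap_add_line U W x :
  x \notin (U + W)%VS ->
  \dim ((U + <[x]>) :&: (W + <[x]>)) = (\dim (U :&: W)).+1.
Proof.
move=> xUW.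
have xU : x \notin U by apply: contra xUW; apply/subvP/addvSl.
have xW : x \notin W by apply: contra xUW; apply/subvP/addvSr.
have := dimv_sum_cap (U + <[x]>) (W + <[x]>).
rewrite addvA -(addvA U) (addvC <[x]>%VS) (addvA U) -addvA addvv.
by rewrite !dim_add_line //; have := dimv_sum_cap U W; lia.
Qed.

(** This is the triangle inequality for the Grassmann distance: both intersections lie in [Y], and
    their meet lies in [X :&: Z]. *)
Lemma dim_cap_subadditive X Y Z :
  (\dim (X :&: Y) + \dim (Y :&: Z) <= \dim Y + \dim (X :&: Z))%N.
Proof.
have /= := dimv_sum_cap (X :&: Y) (Y :&: Z).
have : (\dim (X :&: Y + Y :&: Z) <= \dim Y)%N.
  by rewrite dimvS // subv_add capvSl capvSr.
have : (\dim ((X :&: Y) :&: (Y :&: Z)) <= \dim (X :&: Z))%N.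
  rewrite dimvS // subv_cap.
  by rewrite (subv_trans (capvSl _ _) (capvSl _ _)) (subv_trans (capvSr _ _) (capvSr _ _)).
lia.
Qed.

End Subspaces.

(** * Walks in the Grassmann graph and in the graph of codes *)

Section Walks.
Variables (F : finFieldType) (n : nat).
Local Notation V := 'rV[F]_n.
Implicit Types (k : nat) (X Y Z H : {vspace V}) (p : seq {vspace V}).

(** By the triangle inequality each step raises the dimension of the intersection with [Y] by at
    most one, and this dimension ends at [k]. *)
Lemma grassmann_path_ge k X Y p :
  \dim Y = k -> path (grassmann_adj k) X p -> last X p = Y ->
  (k <= \dim (X :&: Y) + size p)%N.
Proof.
move=> dimY; elim: p X => [|Z p IHp] X /=; first by move=> _ ->; rewrite capvv dimY addn0.
case/andP=> /and3P[/eqP dimX /eqP dimZ /eqP dimXZ] /IHp{}IHp /IHp.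
have := dim_cap_subadditive X Z Y; lia.
Qed.

(** The intersection contains [H] and is smaller than [H + <[y]>] because [y] lies outside [X];
    hence it is [H]. *)
Lemma grassmann_adj_hyperplane_line k X H y :
  \dim X = k -> (H <= X)%VS -> (\dim H).+1 = k -> y \notin X ->
  grassmann_adj k X (H + <[y]>)%VS.
Proof.
move=> dimX sHX dimH yX.
have yH : y \notin H by apply: contra yX; apply/subvP.
rewrite /grassmann_adj dimX eqxx dim_add_line // dimH eqxx /=.
rewrite (_ : X :&: (H + <[y]>) = H)%VS ?dimH //.
apply/esym/eq_dim_subv; first by rewrite subv_cap sHX addvSl.
rewrite -ltnS -(dim_add_line yH) ltnNge; apply: contra yX => led.
rewrite memvE (subv_trans (addvSr H _)) //.
by rewrite -(eq_dim_subv (capvSr X _) led) capvSl.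
Qed.

(** Each step keeps a hyperplane of [X] through [X :&: Y] and adds a vector of [Y] outside [X],
    gaining one dimension of intersection. The last clause later keeps a vector of full support in
    every vertex. *)
Lemma exists_grassmann_path k X Y :
  \dim X = k -> \dim Y = k ->
  exists p, [/\ path (grassmann_adj k) X p, last X p = Y,
    size p = (k - \dim (X :&: Y))%N
    & all (fun Z => (\dim Z == k) && (X :&: Y <= Z)%VS) p].
Proof.
move: {2}(k - _)%N (erefl (k - \dim (X :&: Y))%N) => d.
elim: d X => [|d IHd] X eqd dimX dimY.
  exists [::]; split=> //=.
  have eqX : (X :&: Y)%VS = X by apply: eq_dim_subv; rewrite ?capvSl //; lia.
  by rewrite -eqX; apply: eq_dim_subv; rewrite ?capvSr //; lia.
have [H [sUH sHX dimH]] : exists H,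
    [/\ (X :&: Y <= H)%VS, (H <= X)%VS & (\dim H).+1 = \dim X].
  by apply: exists_hyperplane_between; rewrite ?capvSl //; lia.
have [y yY yU] : exists2 y, y \in Y & y \notin (X :&: Y)%VS by apply: exists_notin; lia.
have yX : y \notin X by move: yU; rewrite memv_cap yY andbT.
have yH : y \notin H by apply: contra yX; apply/subvP.
have adjXZ := grassmann_adj_hyperplane_line dimX sHX (etrans dimH dimX) yX.
set Z := (H + <[y]>)%VS in adjXZ.
have dimZ : \dim Z = k by case/and3P: adjXZ => _ /eqP.
have sUyZ : (X :&: Y + <[y]> <= Z :&: Y)%VS.
  by rewrite subv_cap addvS // subv_add capvSr -memvE.
have sUZ := subv_trans (addvSl _ _) sUyZ.
(* The triangle inequality through [Z] forbids a gain of more than one. *)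
have dimZY : \dim (Z :&: Y) = (\dim (X :&: Y)).+1.
  apply/anti_leq/andP; split; last by rewrite -(dim_add_line yU) dimvS.
  by have := dim_cap_subadditive X Z Y; case/and3P: adjXZ => _ _ /eqP; lia.
have [||//|p [pathp lastp sizep allp]] := IHd Z.
- by rewrite dimZY subnS eqd.
- exact: dimZ.
exists (Z :: p); split=> //=; first by rewrite adjXZ.
  by rewrite sizep dimZY subnS !eqd.
rewrite dimZ eqxx (subv_trans sUZ (capvSl _ _)) /=.
by apply: sub_all allp => T /andP[-> /(subv_trans sUZ) ->].
Qed.

Lemma path_nondeg k X p :
  nondeg_code k X -> all (nondeg_code k) p -> path (grassmann_adj k) X p ->
  path (@code_adj F n k) X p.
Proof.
elim: p X => //= Z p IHp X cX /andP[cZ cp] /andP[adjXZ pathp].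
by rewrite /code_adj /induced_rel cX cZ adjXZ IHp.
Qed.

Lemma code_path_grassmann k X p :
  path (@code_adj F n k) X p -> path (grassmann_adj k) X p.
Proof. by apply: sub_path => Y Z /and3P[]. Qed.

Lemma graph_dist_grassmann k X Y :
  \dim X = k -> \dim Y = k ->
  graph_dist (grassmann_adj k) X Y (k - \dim (X :&: Y))%N.
Proof.
move=> dimX dimY; split=> [|p pathp lastp]; last first.
  by rewrite leq_subLR; exact: grassmann_path_ge dimY pathp lastp.
by have [p [? ? ? _]] := exists_grassmann_path dimX dimY; exists p.
Qed.

Lemma nondeg_code_full_support k X (w : V) :
  \dim X = k -> w \in X -> (forall i, w 0 i != 0) -> nondeg_code k X.
Proof.
move=> dimX wX w_neq0; rewrite /nondeg_code dimX eqxx; apply/forallP => i.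
by apply: contra (w_neq0 i) => /subvP/(_ w wX); rewrite mem_coord_hyperplane.
Qed.

(** * Pairs of codes between which every first step of a geodesic is blocked *)

Section BlockedPair.
Variables (k : nat) (X Y : {vspace V}).
Hypotheses (codeX : nondeg_code k X) (codeY : nondeg_code k Y).
Hypothesis dimXY : (\dim (X :&: Y) + 2 <= k)%N.
Hypothesis blocked : forall H y, (X :&: Y <= H)%VS -> (H <= X)%VS ->
  (\dim H).+1 = k -> y \in Y ->
  exists2 i, (H <= coord_hyperplane F i)%VS & y 0 i = 0.

Let dimX : \dim X = k. Proof. by case/andP: codeX => /eqP. Qed.
Let dimY : \dim Y = k. Proof. by case/andP: codeY => /eqP. Qed.

(** Since [X :&: Y] has codimension at least two in [X], it fits together with [x] into a hyperplane
    [H] of [X]; a coordinate vanishing on [H] and at [y] vanishes at [x + y]. *)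
Lemma blocked_sum_has_zero w : w \in (X + Y)%VS -> exists i, w 0 i = 0.
Proof.
case/memv_addP=> x xX [y yY ->].
have [H [sUH sHX dimH]] : exists H,
    [/\ (X :&: Y + <[x]> <= H)%VS, (H <= X)%VS & (\dim H).+1 = \dim X].
  apply: exists_hyperplane_between; first by rewrite subv_add capvSl -memvE.
  rewrite dimX; apply: leq_ltn_trans (dimv_add_leqif _ _).1 _.
  by rewrite dim_vline; case: (x != 0); lia.
have [i /subvP sHi yi] := blocked (subv_trans (addvSl _ _) sUH) sHX (etrans dimH dimX) yY.
exists i; rewrite mxE yi addr0; apply/eqP; rewrite -mem_coord_hyperplane; apply: sHi.
by move: sUH; rewrite subv_add -memvE => /andP[].
Qed.

Lemma blocked_code_path_ge p :
  path (@code_adj F n k) X p -> last X p = Y -> (k - \dim (X :&: Y) < size p)%N.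
Proof.
case: p => [|Z p] /= => [_ eqXY|/andP[/and3P[_ codeZ adjXZ] pathp] lastp].
  by move: dimXY; rewrite -eqXY capvv dimX; lia.
rewrite ltnNge; apply/negP => le_size.
have leZY := grassmann_path_ge dimY (code_path_grassmann pathp) lastp.
case/and3P: adjXZ => _ /eqP dimZ /eqP dimXZ.
have gtZY : (\dim (X :&: Y) < \dim (Z :&: Y))%N by lia.
have sUZ : (X :&: Y <= Z)%VS.
  (* Inside [Z], of dimension [k], the hyperplane [X :&: Z] cuts the dimension of [Z :&: Y] by at
     most one, so the meet is large enough to fill [X :&: Y]. *)
  have -> : (X :&: Y = (X :&: Z) :&: (Z :&: Y))%VS.
    apply/esym/eq_dim_subv.
      by rewrite subv_cap (subv_trans (capvSl _ _) (capvSl _ _)) (subv_trans (capvSr _ _) (capvSr _ _)).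
    have /= := dimv_sum_cap (X :&: Z) (Z :&: Y).
    have : (\dim (X :&: Z + Z :&: Y) <= \dim Z)%N.
      by rewrite dimvS // subv_add capvSl capvSr.
    by lia.
  exact: subv_trans (capvSl _ _) (capvSr _ _).
have [y] := exists_notin gtZY; rewrite !memv_cap => /andP[yZ yY]; rewrite yY andbT => yX.
have sUXZ : (X :&: Y <= X :&: Z)%VS by rewrite subv_cap capvSl.
have [i sHi yi] := blocked sUXZ (capvSl _ _) dimXZ yY.
have yXZ : y \notin (X :&: Z)%VS by rewrite memv_cap (negPf yX).
have eqZ : (X :&: Z + <[y]> = Z)%VS.
  apply: eq_dim_subv; first by rewrite subv_add capvSr -memvE.
  by rewrite dim_add_line // dimXZ dimZ.
case/andP: codeZ => _ /forallP/(_ i)/negP; apply.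
by rewrite -eqZ subv_add sHi -memvE mem_coord_hyperplane yi eqxx.
Qed.

Lemma exists_blocked_code_path :
  exists p, [/\ path (@code_adj F n k) X p, last X p = Y
    & size p = (k - \dim (X :&: Y) + 1)%N].
Proof.
pose w : V := const_mx 1.
have w_neq0 i : w 0 i != 0 by rewrite mxE oner_eq0.
have wXY : w \notin (X + Y)%VS.
  by apply/negP => /blocked_sum_has_zero[i /eqP]; rewrite (negPf (w_neq0 i)).
have wX : w \notin X by apply: contra wXY; apply/subvP/addvSl.
have wY : w \notin Y by apply: contra wXY; apply/subvP/addvSr.
have [H [sUH sHX dimH]] : exists H,
    [/\ (X :&: Y <= H)%VS, (H <= X)%VS & (\dim H).+1 = \dim X].
  by apply: exists_hyperplane_between; rewrite ?capvSl //; lia.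
have [L [sUL sLY dimL]] : exists L,
    [/\ (X :&: Y <= L)%VS, (L <= Y)%VS & (\dim L).+1 = \dim Y].
  by apply: exists_hyperplane_between; rewrite ?capvSr //; lia.
have adjX := grassmann_adj_hyperplane_line dimX sHX (etrans dimH dimX) wX.
have adjY := grassmann_adj_hyperplane_line dimY sLY (etrans dimL dimY) wY.
set X1 := (H + <[w]>)%VS in adjX; set Y1 := (L + <[w]>)%VS in adjY.
have dimX1 : \dim X1 = k by case/and3P: adjX => _ /eqP.
have dimY1 : \dim Y1 = k by case/and3P: adjY => _ /eqP.
have wX1 : w \in X1 by rewrite memvE addvSr.
have wY1 : w \in Y1 by rewrite memvE addvSr.
have eqHL : (H :&: L = X :&: Y)%VS.
  by apply/eqP; rewrite eqEsubv capvS // subv_cap sUH.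
have wHL : w \notin (H + L)%VS by apply: contra wXY; apply/subvP/addvS.
have dimXY1 : \dim (X1 :&: Y1) = (\dim (X :&: Y)).+1.
  by rewrite -eqHL; apply: dim_cap_add_line.
have [p [pathp lastp sizep allp]] := exists_grassmann_path dimX1 dimY1.
have codeX1 := nondeg_code_full_support dimX1 wX1 w_neq0.
have codeY1 := nondeg_code_full_support dimY1 wY1 w_neq0.
have codep : all (nondeg_code k) p.
  apply: sub_all allp => Z /andP[/eqP dimZ /subvP sZ].
  by apply: nondeg_code_full_support w_neq0; rewrite // sZ // memv_cap wX1.
(* Two outer steps surround an inner geodesic that is one shorter than the Grassmann distance of [X]
   and [Y]. *)
exists (X1 :: rcons p Y); rewrite /= last_rcons size_rcons; split=> //.
  rewrite rcons_path /code_adj /induced_rel codeX codeX1 adjX /=.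
  apply/andP; split; first exact: path_nondeg.
  rewrite lastp codeY1 codeY /=.
  by move: adjY; rewrite /grassmann_adj capvC => /and3P[-> -> ->].
rewrite sizep dimXY1 subnS prednK ?addn1 // subn_gt0.
by apply: leq_trans dimXY; rewrite addn2 ltnW.
Qed.

Lemma graph_dist_blocked_code :
  graph_dist (@code_adj F n k) X Y (k - \dim (X :&: Y) + 1)%N.
Proof.
split=> [|p pathp lastp]; first exact: exists_blocked_code_path.
by rewrite addn1 blocked_code_path_ge.
Qed.

End BlockedPair.

End Walks.

(** * Points and lines of projective space *)

Section LineRepresentatives.
Variables (F : finFieldType).

(** The points of PG(t-1,q): [vpick] depends only on the subspace, so proportional vectors share one
    representative. *)
Definition line_reps t : {set 'cV[F]_t} := [set vpick <[v]>%VS | v : 'cV[F]_t in [set~ 0]].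

Lemma line_reps_neq0 t (s : 'cV[F]_t) : s \in line_reps t -> s != 0.
Proof.
by case/imsetP=> v /[!inE] v0 ->; rewrite vpick0 -subv0 -memvE memv0.
Qed.

Lemma exists_line_rep t (v : 'cV[F]_t) :
  v != 0 -> exists2 c : F, c != 0 & c *: v \in line_reps t.
Proof.
move=> v0; have vL : vpick <[v]>%VS \in line_reps t.
  by apply: imset_f; rewrite !inE.
have /vlineP[c eqv] := memv_pick <[v]>%VS.
exists c; last by rewrite -eqv.
by have := line_reps_neq0 vL; rewrite eqv scaler_eq0 negb_or => /andP[].
Qed.

(** Scaling embeds pairs of a nonzero scalar and a representative into the nonzero vectors: the
    product determines its line, hence the representative, hence the scalar. *)
Lemma card_line_reps t : (#|line_reps t| <= qint #|F| t)%N.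
Proof.
have q_gt1 : (1 < #|F|)%N by apply: card_finNzRing_gt1.
rewrite /qint leq_divRL; last by rewrite subn_gt0.
have -> : (#|F| ^ t - 1 = #|[set~ (0%R : 'cV[F]_t)]|)%N.
  by rewrite cardsC1 card_mx muln1 subn1.
have -> : (#|F| - 1 = #|[set~ (0%R : F)]|)%N by rewrite cardsC1 subn1.
rewrite mulnC -cardsX -(@card_in_imset _ _ (fun cs : F * 'cV[F]_t => cs.1 *: cs.2)).
  apply/subset_leq_card/subsetP=> _ /imsetP[[c s] /setXP[/= /[!inE] c0 /line_reps_neq0 s0] ->].
  by rewrite scaler_eq0 negb_or c0.
have line_scale (c : F) (v : 'cV[F]_t) : c != 0 -> (<[c *: v]> = <[v]>)%VS.
  move=> c0; apply/eqP; rewrite eqEsubv -!memvE memvZ ?memv_line //=.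
  by rewrite -[X in X \in _](scalerK c0) memvZ ?memv_line.
have rep_line s : s \in line_reps t -> vpick <[s]>%VS = s.
  move=> sL; have s0 := line_reps_neq0 sL.
  case/imsetP: sL s0 => v _ ->; have /vlineP[c eqv] := memv_pick <[v]>%VS.
  by rewrite {1 2}eqv scaler_eq0 negb_or => /andP[c0 _]; rewrite line_scale.
move=> [c s] [c' s'] /[!inE] /= /andP[c0 sL] /andP[c0' sL'] eqcs.
have eqs : s = s'.
  by rewrite -(rep_line s) // -(line_scale c) // eqcs line_scale // rep_line.
rewrite eqs in eqcs *; congr (_, _).
apply/eqP; rewrite -subr_eq0; have /eqP := eqcs; rewrite -subr_eq0 -scalerBl.
by rewrite scaler_eq0 (negPf (line_reps_neq0 sL')) orbF.
Qed.

(** Ties the factor q + 1 of the bound to the points of a projective line. *)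
Lemma qint2 : qint #|F| 2 = (#|F| + 1)%N.
Proof.
have q_gt1 : (1 < #|F|)%N by apply: card_finNzRing_gt1.
rewrite /qint (_ : #|F| ^ 2 - 1 = (#|F| + 1) * (#|F| - 1))%N ?mulnK ?subn_gt0 //.
by rewrite mulnC -[X in (_ - X)%N](exp1n 2) subn_sqr.
Qed.

(** A linear form in at least two variables has a nonzero kernel vector, which rescales to a
    representative. *)
Lemma exists_line_rep_kernel t (h : 'rV[F]_t) :
  (1 < t)%N -> exists2 s, s \in line_reps t & h *m s = 0.
Proof.
move=> t_gt1; pose f : 'Hom('cV[F]_t, 'M[F]_1) := linfun (mulmx h).
have kerN0 : (lker f != 0)%VS.
  rewrite -dimv_eq0; have := limg_ker_dim f fullv; rewrite capfv !dimvf /dim /= muln1.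
  by have := dimvS (subvf (limg f)); rewrite dimvf /dim /= muln1; lia.
have [|c c0 cL] := @exists_line_rep t (vpick (lker f)); first by rewrite vpick0.
have := memv_pick (lker f); rewrite memv_ker lfunE /= => /eqP eq0.
by exists (c *: vpick (lker f)) => //; rewrite -scalemxAr eq0 scaler0.
Qed.

(** A multiple of each standard basis vector is a representative. *)
Lemma line_reps_separate t (h : 'rV[F]_t) :
  (forall s, s \in line_reps t -> h *m s = 0) -> h = 0.
Proof.
move=> h0; apply/rowP=> j; rewrite mxE.
have [|c c0 /h0] := @exists_line_rep t (delta_mx j 0).
  by apply/eqP => /matrixP/(_ j 0); rewrite !mxE !eqxx; apply/eqP/oner_neq0.
rewrite -scalemxAr -colE => /matrixP/(_ 0 0); rewrite !mxE => /eqP.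
by rewrite mulf_eq0 (negPf c0) => /eqP.
Qed.

(** The columns of [E] are [s] and a vector outside its span, so [E] parametrises a projective line
    through [s]. *)
Lemma exists_pencil t (s : 'cV[F]_t) : (1 < t)%N -> s != 0 ->
  exists E : 'M[F]_(t, 2),
    (forall g : 'cV_2, E *m g = 0 -> g = 0) /\ (exists g, E *m g = s).
Proof.
move=> t_gt1 s0.
have [s' _ s's] : exists2 s', s' \in (fullv : {vspace 'cV[F]_t}) & s' \notin <[s]>%VS.
  by apply: exists_notin; rewrite dim_vline s0 dimvf /dim /= muln1.
have mulE (g : 'cV[F]_(1 + 1)) : row_mx s s' *m g = g 0 0 *: s + g 1 0 *: s'.
  rewrite -{1}[g]vsubmxK mul_row_col (mx11_scalar (usubmx g)) (mx11_scalar (dsubmx g)).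
  by rewrite !mul_mx_scalar !mxE; congr (g _ _ *: _ + g _ _ *: _); apply: val_inj.
exists (row_mx s s'); split=> [g|]; last first.
  by exists (delta_mx 0 0); rewrite mulE !mxE /= scale1r scale0r addr0.
rewrite mulE => eq0.
have g1 : g 1 0 = 0.
  apply/eqP; apply: contraR s's => g1; rewrite -(scalerK g1 s') memvZ //.
  by rewrite -[X in X \in _](addKr (g 0 0 *: s)) eq0 addr0 -scaleNr memvZ ?memv_line.
move: eq0; rewrite g1 scale0r addr0 => /eqP; rewrite scaler_eq0 (negPf s0) orbF => /eqP g0.
apply/colP=> i; rewrite mxE; case: (unliftP 0 i) => [j ->|->//].
by rewrite ord1 -g1; congr (g _ _); apply: val_inj.
Qed.

(* The columns of [A] run over all points of PG(t-1,q); over a fixed point [s] the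
   columns of [B] run over a line of PG(t-1,q) through [s]. Every vector is
   annihilated by some point of every line, which gives the third clause. *)
Lemma exists_pencil_matrices t r :
  (1 < t)%N -> (qint #|F| t * (#|F| + 1) <= r)%N ->
  exists A B : 'M[F]_(t, r),
    [/\ forall j, col j A != 0, forall j, col j B != 0,
        forall v (b : 'rV_t), v != 0 ->
          exists j (c : F), col j A = c *: v /\ b *m col j B = 0
      & forall a b : 'rV_t, a *m A + b *m B = 0 -> a = 0 /\ b = 0].
Proof.
move=> t_gt1 le_r.
have /fin_all_exists[E E_P] (s : 'cV[F]_t) : exists E : 'M[F]_(t, 2), s != 0 ->
    (forall g : 'cV_2, E *m g = 0 -> g = 0) /\ (exists g, E *m g = s).
  have [->|s0] := eqVneq s 0; first by exists 0 => /negP; case.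
  by have [E0 ?] := exists_pencil t_gt1 s0; exists E0.
(* One block per point [s], pairing [s] with each point of the line parametrised by [E s]. *)
pose L := [seq (s, E s *m g) | s <- enum (line_reps t), g <- enum (line_reps 2)].
have sizeL : (size L <= r)%N.
  rewrite size_allpairs -!cardE -qint2 in le_r *.
  by apply: leq_trans le_r; apply: leq_mul; apply: card_line_reps.
have memL s g : s \in line_reps t -> g \in line_reps 2 -> (s, E s *m g) \in L.
  by move=> sL gL; apply: allpairs_f; rewrite mem_enum.
have [s0 s0L _] := exists_line_rep_kernel 0 t_gt1.
have [g0 g0L _] := exists_line_rep_kernel 0 (ltnSn 1).
(* When [r] exceeds the length of [L], the extra columns repeat this default, itself a member of
   [L], so they stay nonzero. *)
pose d := (s0, E s0 *m g0).
have nthL (j : nat) : nth d L j \in L.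
  have [lt_jL|le_Lj] := ltnP j (size L); first exact: mem_nth.
  by rewrite nth_default ?memL.
have colL p : p \in L -> exists j : 'I_r, nth d L j = p.
  move=> pL; have ltr : (index p L < r)%N by rewrite (leq_trans _ sizeL) ?index_mem.
  by exists (Ordinal ltr); rewrite /= nth_index.
pose A := \matrix_(i < t, j < r) (nth d L j).1 i 0; pose B := \matrix_(i < t, j < r) (nth d L j).2 i 0.
have colA j : col j A = (nth d L j).1 by apply/colP=> i; rewrite !mxE.
have colB j : col j B = (nth d L j).2 by apply/colP=> i; rewrite !mxE.
have L_P p : p \in L -> exists s g, [/\ s \in line_reps t, g \in line_reps 2 & p = (s, E s *m g)].
  by case/allpairsP=> -[s g] [/=]; rewrite !mem_enum => ? ? ->; exists s, g.
exists A, B; split.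
- by move=> j; rewrite colA; have [s [g [/line_reps_neq0 ? _ ->]]] := L_P _ (nthL j).
- move=> j; rewrite colB; have [s [g [/line_reps_neq0 s_neq0 /line_reps_neq0 g_neq0 ->]]] := L_P _ (nthL j).
  by apply: contraNneq g_neq0 => /(E_P _ s_neq0).1 ->.
- move=> v b /exists_line_rep[c c0 cL].
  have [g gL bg] := exists_line_rep_kernel (b *m E (c *: v)) (ltnSn 1).
  have [j eqj] := colL _ (memL _ _ cL gL).
  by exists j, c; rewrite colA colB eqj mulmxA.
- move=> a b ab0.
  have abL s g : s \in line_reps t -> g \in line_reps 2 -> a *m s + (b *m E s) *m g = 0.
    move=> sL gL; have [j eqj] := colL _ (memL _ _ sL gL).
    have := congr1 (mulmxr (delta_mx j 0 : 'cV_r)) ab0.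
    by rewrite /= mulmxDl mul0mx -!mulmxA -!colE colA colB eqj mulmxA.
  (* A point [g] killed by [b *m E s] isolates the term in [a]. *)
  have as0 s : s \in line_reps t -> a *m s = 0.
    move=> sL; have [g gL bg] := exists_line_rep_kernel (b *m E s) (ltnSn 1).
    by have := abL s g sL gL; rewrite bg addr0.
  split; apply: line_reps_separate => // s sL.
  (* With [a] gone, [b] vanishes on the whole line of [s], which contains [s]. *)
  have bE0 : b *m E s = 0.
    by apply: line_reps_separate => g gL; have := abL s g sL gL; rewrite as0 // add0r.
  have [_ [g <-]] := E_P s (line_reps_neq0 sL).
  by rewrite mulmxA bE0 mul0mx.
Qed.

End LineRepresentatives.

(** Take a column of the identity minus the projection onto [U]: all of them kill [U], and some
    column is nonzero since [U] is proper. *)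
Lemma exists_annihilator (F : fieldType) t (U : {vspace 'rV[F]_t}) :
  ~~ (fullv <= U)%VS ->
  exists2 v : 'cV[F]_t, v != 0 & forall a, a \in U -> a *m v = 0.
Proof.
case/subvPn=> a0 _ a0U; pose M := 1%:M - lin1_mx (projv U).
have aM a : a *m M = a - projv U a by rewrite mulmxBr mulmx1 mul_rV_lin1.
have /existsP[j Mj] : [exists j, col j M != 0].
  apply: contraR a0U => /existsPn M0.
  rewrite -[a0](subrK (projv U a0)) -aM.
  rewrite (_ : a0 *m M = 0) ?add0r ?memv_proj //.
  apply/rowP=> j; have /negPn/eqP/matrixP colj := M0 j.
  by rewrite !mxE big1 // => i _; have := colj i 0; rewrite !mxE => ->; rewrite mulr0.
exists (col j M) => // a aU.
by rewrite colE mulmxA aM projv_id // subrr mul0mx.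
Qed.

(** * The codes built from a pair of matrices *)

Section SystematicCodes.
Variables (F : finFieldType) (m t r : nat).
Implicit Types A B : 'M[F]_(t, r).

(** The direct sum of F^m and the row space of [A]; the summand F^m becomes the common part of the
    two codes. *)
Definition systematic_code A : {vspace 'rV[F]_(m + r)} :=
  limg (linfun (mulmxr (block_mx 1%:M 0 0 A)) : 'Hom('rV[F]_(m + t), 'rV[F]_(m + r))).

Lemma systematic_codeP A x :
  reflect (exists u a, x = row_mx u (a *m A)) (x \in systematic_code A).
Proof.
apply: (iffP memv_imgP) => [[v _ ->]|[u [a ->]]].
  exists (lsubmx v), (rsubmx v).
  by rewrite lfunE /= -{1}[v]hsubmxK mul_row_block !mulmx0 mulmx1 add0r addr0.
exists (row_mx u a); first exact: memvf.
by rewrite lfunE /= mul_row_block !mulmx0 mulmx1 add0r addr0.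
Qed.

Lemma dim_systematic_code A :
  (forall a : 'rV_t, a *m A = 0 -> a = 0) -> \dim (systematic_code A) = (m + t)%N.
Proof.
move=> injA; rewrite limg_dim_eq ?dimvf /dim /= ?mul1n //.
apply/eqP; rewrite -subv0; apply/subvP=> v; rewrite memv_cap memv_ker memv0 lfunE /= => /andP[_].
rewrite -{1}[v]hsubmxK mul_row_block !mulmx0 mulmx1 add0r addr0.
rewrite -[X in _ == X]row_mx0 => /eqP/eq_row_mx[u0 /injA a0].
by rewrite -[v]hsubmxK u0 a0 row_mx0.
Qed.

(** Unit vectors settle the first [m] coordinates, and the nonzero columns of [A] the others. *)
Lemma systematic_code_not_sub_coord A i :
  (forall j, col j A != 0) -> ~~ (systematic_code A <= coord_hyperplane F i)%VS.
Proof.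
move=> colA; apply/negP => /subvP sAi.
have {}sAi (u : 'rV_m) (a : 'rV_t) : row_mx u (a *m A) 0 i = 0.
  by apply/eqP; rewrite -mem_coord_hyperplane sAi //; apply/systematic_codeP; exists u, a.
case: (split_ordP i) => j eqi; rewrite eqi in sAi.
  have := sAi (delta_mx 0 j) 0; rewrite row_mxEl mxE !eqxx => /eqP.
  by rewrite oner_eq0.
case/negP: (colA j); apply/eqP/colP => l.
by have := sAi 0 (delta_mx 0 l); rewrite row_mxEr -rowE !mxE.
Qed.

Lemma nondeg_systematic_code A :
  (forall a : 'rV_t, a *m A = 0 -> a = 0) -> (forall j, col j A != 0) ->
  nondeg_code (m + t) (systematic_code A).
Proof.
move=> injA colA; rewrite /nondeg_code dim_systematic_code // eqxx.
by apply/forallP => i; apply: systematic_code_not_sub_coord.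
Qed.

Variables A B : 'M[F]_(t, r).
Hypothesis injAB : forall a b : 'rV_t, a *m A + b *m B = 0 -> a = 0 /\ b = 0.
Local Notation X := (systematic_code A).
Local Notation Y := (systematic_code B).

(** By [injAB] the row spaces of [A] and [B] meet trivially, which leaves only F^m in common. *)
Lemma mem_systematic_cap x : (x \in (X :&: Y)%VS) = (rsubmx x == 0).
Proof.
rewrite memv_cap; apply/andP/eqP => [[/systematic_codeP[u [a ->]]]|x0].
  case/systematic_codeP=> u' [b] /eq_row_mx[_ eqab]; rewrite row_mxKr.
  have [|-> _] := @injAB a (- b); first by rewrite eqab mulNmx subrr.
  by rewrite mul0mx.
by split; apply/systematic_codeP; exists (lsubmx x), 0; rewrite mul0mx -x0 hsubmxK.
Qed.

Lemma dim_systematic_cap : \dim (X :&: Y) = m.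
Proof.
pose f : 'Hom('rV[F]_m, 'rV[F]_(m + r)) := linfun (@mulmxr F 1 m (m + r) (row_mx 1%:M 0)).
have fE u : f u = row_mx u 0 by rewrite lfunE /= mul_mx_row mulmx1 mulmx0.
have -> : (X :&: Y)%VS = limg f.
  apply/vspaceP=> x; rewrite mem_systematic_cap.
  apply/eqP/memv_imgP=> [x0|[u _ ->]]; last by rewrite fE row_mxKr.
  by exists (lsubmx x); rewrite ?memvf // fE -x0 hsubmxK.
rewrite limg_dim_eq ?dimvf /dim /= ?mul1n //.
apply/eqP; rewrite -subv0; apply/subvP=> u; rewrite memv_cap memv_ker memv0 fE.
by rewrite -row_mx0 => /andP[_ /eqP/eq_row_mx[-> _]].
Qed.

(** Modulo [X :&: Y], [H] is a proper subspace of F^t and so is killed by some [v]; among the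
    columns of [A] proportional to [v] there is one whose partner in [B] kills [b]. *)
Lemma systematic_blocked (H : {vspace 'rV[F]_(m + r)}) y :
  (forall v (b : 'rV_t), v != 0 ->
     exists j (c : F), col j A = c *: v /\ b *m col j B = 0) ->
  (X :&: Y <= H)%VS -> (H <= X)%VS -> (\dim H).+1 = (m + t)%N -> y \in Y ->
  exists2 i, (H <= coord_hyperplane F i)%VS & y 0 i = 0.
Proof.
move=> annAB sUH sHX dimH /systematic_codeP[u' [b ->]].
pose f : 'Hom('rV[F]_t, 'rV[F]_(m + r)) := linfun (@mulmxr F 1 t (m + r) (row_mx 0 A)).
have fE a : f a = row_mx 0 (a *m A) by rewrite lfunE /= mul_mx_row mulmx0.
have subH (u : 'rV_m) (a : 'rV_t) : (row_mx u (a *m A) \in H) = (a \in (f @^-1: H)%VS).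
  rewrite -memv_preim fE (_ : row_mx u _ = row_mx u 0 + row_mx 0 (a *m A)); last first.
    by rewrite add_row_mx addr0 add0r.
  by rewrite rpredDl // (subvP sUH) // mem_systematic_cap row_mxKr.
have [|v v0 vH] := @exists_annihilator F t (f @^-1: H)%VS.
  (* If the preimage were everything, [H] would contain [X], against its dimension. *)
  apply: contra_eqN dimH => /subvP full.
  have injA (a : 'rV_t) : a *m A = 0 -> a = 0.
    by move=> aA; have [|-> _ //] := @injAB a 0; rewrite mul0mx addr0.
  rewrite -(dim_systematic_code injA) neq_ltn ltnS; apply/orP; right.
  by apply/dimvS/subvP=> _ /systematic_codeP[u [a ->]]; rewrite subH full ?memvf.
have [j [c [Aj bj]]] := annAB v b v0.
exists (rshift m j); last first.
  by rewrite row_mxEr; have /matrixP/(_ 0 0) := bj; rewrite colE mulmxA -colE !mxE.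
apply/subvP=> x xH; have /systematic_codeP[u [a eqx]] := subvP sHX x xH.
rewrite mem_coord_hyperplane eqx row_mxEr; apply/eqP.
have : a *m col j A = 0 by rewrite Aj -scalemxAr vH ?scaler0 // -(subH u) -eqx.
by move/matrixP/(_ 0 0); rewrite colE mulmxA -colE !mxE.
Qed.

End SystematicCodes.

Theorem theorem2 (F : finFieldType) (n k m : nat)
    (hk1 : (1 < k)%N) (hkn : (k < n - 1)%N)
    (hm1 : (mnk n k <= m)%N) (hm2 : (m <= k - 2)%N)
    (hn : (qint #|F| (k - m) * (#|F| + 1) + m <= n)%N) :
  exists X Y : {vspace 'rV[F]_n},
    [/\ nondeg_code k X,
        nondeg_code k Y,
        graph_dist (grassmann_adj k) X Y (k - m)%N
      & graph_dist (code_adj k) X Y (k - m + 1)%N].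
Proof.
have [t eqk] : exists t, k = (m + t)%N by exists (k - m)%N; lia.
have [r eqn] : exists r, n = (m + r)%N by exists (n - m)%N; lia.
have t_gt1 : (1 < t)%N by lia.
(* Without the [m] common coordinates, the bound leaves room for a block of q + 1 columns at every
   point of PG(t-1,q). *)
subst k n; rewrite !addKn addnC leq_add2l in hn *.
have [A [B [colA colB annAB injAB]]] := exists_pencil_matrices t_gt1 hn.
have injA (a : 'rV_t) : a *m A = 0 -> a = 0.
  by move=> aA; have [|-> _ //] := @injAB a 0; rewrite mul0mx addr0.
have injB (b : 'rV_t) : b *m B = 0 -> b = 0.
  by move=> bB; have [|_ -> //] := @injAB 0 b; rewrite mul0mx add0r.
have codeX := nondeg_systematic_code m injA colA.
have codeY := nondeg_systematic_code m injB colB.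
have dimXY := dim_systematic_cap m injAB.
exists (systematic_code m A), (systematic_code m B); split=> //.
  have := graph_dist_grassmann (dim_systematic_code m injA) (dim_systematic_code m injB).
  by rewrite dimXY addKn.
have := @graph_dist_blocked_code F _ _ _ _ codeX codeY.
rewrite dimXY addKn leq_add2l; apply=> // H y.
exact: systematic_blocked.
Qed.
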